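(* Let $u,v\in\mathcal{H}\setminus\Delta$, with $F,G$ the corresponding Carathéodory series, let $p\in\mathbb{Z}$, and let $L,M\in\Lambda$ be such that $(L^{*_p},M^{*_p})=(L,M)$ and $uL=vM$. Let $FL=GM+C$ be the corresponding linear spectral transformation, i.e. $C=FL-GM$ (which is an element of $\Lambda$). Then $uL=vM$ is minimal if and only if $1\in\gcd(L,M,C)$, i.e. $L,M,C$ are coprime in $\Lambda$.
   Context: $\Lambda=\mathbb{C}[z,z^{-1}]$ is the ring of complex Laurent polynomials, $\Lambda_0=\Lambda\setminus\{0\}$, and $\mathrm{U}=\{\alpha z^k : \alpha\in\mathbb{C}\setminus\{0\},\ k\in\mathbb{Z}\}$ is its group of units; greatest common divisors in $\Lambda$ are defined up to factors in $\mathrm{U}$. For $H\in\Lambda$, $H_*(z)=\overline{H(1/\overline{z})}$ and, for $p\in\mathbb{Z}$, $H^{*_p}(z)=z^pH_*(z)$. $\Lambda'=\operatorname{Hom}(\Lambda,\mathbb{C})$. For $u\in\Lambda'$ and $L\in\Lambda$, the functional $uL\in\Lambda'$ is defined by $uL[f]=u[Lf]$. A functional $u\in\Lambda'$ with moments $\mu_n=u[z^n]$, $n\in\mathbb{Z}$, is hermitian if $\mu_{-n}=\overline{\mu_n}$ for all $n$; $\mathcal{H}$ denotes the set of hermitian functionals. $\Delta=\{u\in\mathcal{H} : \exists\, L\in\Lambda_0 \text{ such that } uL=0\}$. The Carathéodory series of $u\in\mathcal{H}$ is the formal power series $F(z)=\mu_0+2\sum_{n\ge1}\mu_{-n}z^n$;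 products $FL$ with $L\in\Lambda$ are formal Laurent series with finitely many negative powers of $z$. Let $\mathbb{I}(u,v)=\{(L,M)\in\Lambda_0\times\Lambda_0 : uL=vM\}$. Write $(L_0,M_0)\le(L_1,M_1)$ iff $(L_1,M_1)=(NL_0,NM_0)$ for some $N\in\Lambda$, and $(L_0,M_0)\equiv(L_1,M_1)$ iff $(L_1,M_1)=(NL_0,NM_0)$ for some $N\in\mathrm{U}$. ''$uL=vM$ is minimal'' means that $(L,M)\in\mathbb{I}(u,v)$ and every $(L_1,M_1)\in\mathbb{I}(u,v)$ with $(L_1,M_1)\le(L,M)$ satisfies $(L_1,M_1)\equiv(L,M)$. *)

(* Defs.v *)
From HB Require Import structures.
From mathcomp Require Import all_boot all_order all_algebra.
From mathcomp Require Import finmap.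
From mathcomp Require Import monalg.
From mathcomp Require Import complex reals.

Set Implicit Arguments.
Unset Strict Implicit.
Unset Printing Implicit Defensive.

Import Order.TTheory GRing.Theory Num.Theory.

Local Open Scope ring_scope.

(* [monalg] puts a ring structure on {malg K[M]} only for monoids M without   *)
(* nontrivial units, which excludes int; hence the alias and the ring         *)
(* structure below. The additive and scaling structures are those of malg.    *)
Definition laurent (K : fieldType) : Type := {malg K[int]}.

Section LaurentRing.
Variable K : fieldType.

HB.instance Definition _ := GRing.Lmodule.copy (laurent K) {malg K[int]}.

Implicit Types (f g h : laurent K).

Definition lone : laurent K := << 1 *g 0 >>.

Definition lmul f g : laurent K :=
  \sum_(i <- msupp f) \sum_(j <- msupp g) << f@_i * g@_j *g i + j >>.

Lemma lmulE f g (d e : {fset int}) :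
  (msupp f `<=` d)%fset -> (msupp g `<=` e)%fset ->
  lmul f g = \sum_(i <- d) \sum_(j <- e) << f@_i * g@_j *g i + j >>.
Proof.
move=> fd ge; rewrite /lmul (big_fset_incl _ fd) /=.
  apply: eq_bigr => i _; apply: big_fset_incl ge _ => j _ /mcoeff_outdom ->.
  by rewrite mulr0 monalgU0.
move=> i _ /mcoeff_outdom ->.
by rewrite big1 // => j _; rewrite mul0r monalgU0.
Qed.

Fact lmulC : commutative lmul.
Proof.
move=> f g; rewrite /lmul exchange_big /=.
by apply: eq_bigr => i _; apply: eq_bigr => j _; rewrite mulrC addrC.
Qed.

Fact lmulDl : left_distributive lmul +%R.
Proof.
move=> f g h; pose d := (msupp f `|` msupp g `|` msupp (f + g))%fset.
have [fd gd sd] : [/\ (msupp f `<=` d)%fset, (msupp g `<=` d)%fset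
                    & (msupp (f + g) `<=` d)%fset].
  split; rewrite /d.
  - exact: fsubset_trans (fsubsetUl _ _) (fsubsetUl _ _).
  - exact: fsubset_trans (fsubsetUr _ _) (fsubsetUl _ _).
  - exact: fsubsetUr.
rewrite !(lmulE (e := msupp h) fd, lmulE (e := msupp h) gd,
          lmulE (e := msupp h) sd) //.
rewrite -big_split /=; apply: eq_bigr => i _.
rewrite -big_split /=; apply: eq_bigr => j _.
by rewrite mcoeffD mulrDl monalgUD.
Qed.

Fact lmulDr : right_distributive lmul +%R.
Proof. by move=> f g h; rewrite lmulC lmulDl !(lmulC f). Qed.

Lemma lmul0l g : lmul 0 g = 0.
Proof. by rewrite /lmul msupp0 big_seq_fset0. Qed.

Lemma lmulUU a b (i j : int) :
  lmul << a *g i >> << b *g j >> = << a * b *g i + j >>.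
Proof.
rewrite (lmulE (msuppU_le (k := i)) (msuppU_le (k := j))).
by rewrite !big_seq_fset1 !mcoeffUU.
Qed.

Lemma lmul_suml (I : Type) (r : seq I) (F : I -> laurent K) g :
  lmul (\sum_(i <- r) F i) g = \sum_(i <- r) lmul (F i) g.
Proof.
apply: (big_morph (lmul^~ g)); last exact: lmul0l.
by move=> x y; rewrite lmulDl.
Qed.

Lemma laurentE f : f = \sum_(i <- msupp f) << f@_i *g i >>.
Proof. exact: monalgE. Qed.

Lemma laurent_ind (P : laurent K -> Prop) :
  P 0 -> (forall f g, P f -> P g -> P (f + g)) ->
  (forall a i, P << a *g i >>) -> forall f, P f.
Proof. by move=> P0 PD PU f; rewrite (laurentE f); apply: big_ind. Qed.

Fact lmulA : associative lmul.
Proof.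
move=> f g h; elim/laurent_ind: f => [|f1 f2|a i]; first by rewrite !lmul0l.
  by rewrite !lmulDl => -> ->.
elim/laurent_ind: g => [|g1 g2|b j].
- by rewrite lmul0l (lmulC _ 0) lmul0l lmul0l.
- by rewrite !(lmulDl, lmulDr) => -> ->.
elim/laurent_ind: h => [|h1 h2|c k].
- by rewrite !(lmulC _ 0) !lmul0l (lmulC _ 0) lmul0l.
- by rewrite !lmulDr => -> ->.
by rewrite !lmulUU mulrA addrA.
Qed.

Fact lmul1l : left_id lone lmul.
Proof.
move=> f; elim/laurent_ind: f => [|f1 f2|a i].
- by rewrite lmulC lmul0l.
- by rewrite lmulDr => -> ->.
by rewrite lmulUU mul1r add0r.
Qed.

Fact lone_neq0 : lone != 0.
Proof.
by apply/eqP => /malgP /(_ 0)/eqP; rewrite mcoeffUU mcoeff0 oner_eq0.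
Qed.

HB.instance Definition _ := GRing.Zmodule_isComNzRing.Build (laurent K)
  lmulA lmulC lmul1l lmulDl lone_neq0.

Fact lscaleAl (a : K) f g : a *: (f * g) = (a *: f) * g.
Proof.
elim/laurent_ind: f => [|f1 f2 e1 e2|b i]; first by rewrite !(scaler0, mul0r).
  by rewrite mulrDl !scalerDr mulrDl e1 e2.
elim/laurent_ind: g => [|g1 g2 e1 e2|c j]; first by rewrite !(scaler0, mulr0).
  by rewrite mulrDr !scalerDr mulrDr e1 e2.
have sU x y (k : int) : x *: (<< y *g k >> : laurent K) = << x * y *g k >>.
  by apply/malgP => n; rewrite mcoeffZ !mcoeffU mulrnAr.
by rewrite sU [LHS](congr1 _ (lmulUU _ _ _ _)) sU [RHS]lmulUU mulrA.
Qed.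

HB.instance Definition _ :=
  GRing.Lmodule_isLalgebra.Build K (laurent K) lscaleAl.
HB.instance Definition _ := GRing.Lalgebra_isComAlgebra.Build K (laurent K).

Lemma lmonM a b (i j : int) :
  (<< a *g i >> : laurent K) * (<< b *g j >> : laurent K) = << a * b *g i + j >>.
Proof. exact: lmulUU. Qed.

Lemma lcoefM f g (n : int) :
  (f * g)@_n = \sum_(i <- msupp f) f@_i * g@_(n - i).
Proof.
rewrite [f * g]/(lmul f g) /lmul raddf_sum /=; apply: eq_bigr => i _.
rewrite [g in g@_(n - i)]laurentE !raddf_sum mulr_sumr /=.
apply: eq_bigr => j _.
by rewrite !mcoeffU mulrnAr (can2_eq (addKr i) (addNKr i)) addrC.
Qed.

Definition zpow (k : int) : laurent K := << 1 *g k >>.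

Definition laurent_eval (x : K) f : K := \sum_(i <- msupp f) f@_i * x ^ i.

Fact laurent_eval_is_scalar x : scalar (laurent_eval x).
Proof.
have w f (d : {fset int}) : (msupp f `<=` d)%fset ->
    laurent_eval x f = \sum_(i <- d) f@_i * x ^ i.
  by move=> fd; apply: big_fset_incl fd _ => i _ /mcoeff_outdom ->; rewrite mul0r.
move=> a f g; pose d := (msupp f `|` msupp g `|` msupp (a *: f + g))%fset.
have [fd gd sd] : [/\ (msupp f `<=` d)%fset, (msupp g `<=` d)%fset
                    & (msupp (a *: f + g) `<=` d)%fset].
  split; rewrite /d.
  - exact: fsubset_trans (fsubsetUl _ _) (fsubsetUl _ _).
  - exact: fsubset_trans (fsubsetUr _ _) (fsubsetUl _ _).
  - exact: fsubsetUr.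
rewrite (w _ _ fd) (w _ _ gd) (w _ _ sd) mulr_sumr -big_split /=.
by apply: eq_bigr => i _; rewrite mcoeffD mcoeffZ mulrDl mulrA.
Qed.

HB.instance Definition _ x := GRing.isLinear.Build K (laurent K) K *%R
  (laurent_eval x) (laurent_eval_is_scalar x).

Lemma laurent_eval_zpow k x : laurent_eval x (zpow k) = x ^ k.
Proof.
by rewrite /laurent_eval msuppU oner_eq0 big_seq_fset1 mcoeffUU mul1r.
Qed.

Definition laurentU f : Prop := exists a k, a != 0 /\ f = a *: zpow k.

Definition ldvd f g : Prop := exists h, g = h * f.

(* D belongs to gcd(s); a gcd is only determined up to a factor in U. *)
Definition is_gcd (s : seq (laurent K)) (D : laurent K) : Prop :=
  (forall f, f \in s -> ldvd D f) /\
  (forall E, (forall f, f \in s -> ldvd E f) -> ldvd E D).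

End LaurentRing.

Section Functionals.
Variable K : numClosedFieldType.

Implicit Types (H L M N : laurent K) (u v : {scalar laurent K}).

(* H_*(z) = conj (H (1 / conj z)) has the coefficient conj H_k at z^(-k). *)
Definition lstar H : laurent K := \sum_(k <- msupp H) (H@_k)^* *: zpow K (- k).

Lemma lstar_eval H (x : K) :
  laurent_eval x (lstar H) = (laurent_eval (x^*)^-1 H)^*.
Proof.
have -> : laurent_eval x (lstar H) =
    \sum_(k <- msupp H) (H@_k)^* * laurent_eval x (zpow K (- k)).
  rewrite /lstar linear_sum /=.
  by apply: eq_bigr => k _; rewrite linearZ.
rewrite /laurent_eval rmorph_sum; apply: eq_bigr => k _.
rewrite -/(laurent_eval _ _) laurent_eval_zpow rmorphM; congr (_ * _).
by rewrite fmorphXz fmorphV /= conjCK exprz_inv.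
Qed.

Definition lstarp (p : int) H : laurent K := zpow K p * lstar H.

Definition fmul u L : laurent K -> K := fun f => u (L * f).

Fact fmul_is_scalar u L : scalar (fmul u L).
Proof. by move=> a f g; rewrite /fmul mulrDr -scalerAr linearP. Qed.

HB.instance Definition _ u L :=
  GRing.isLinear.Build K (laurent K) K *%R (fmul u L) (fmul_is_scalar u L).

Definition moment u (n : int) : K := u (zpow K n).

Definition hermitian_functional u : Prop := forall n, moment u (- n) = (moment u n)^*.

Definition Delta u : Prop :=
  hermitian_functional u /\ exists2 L, L != 0 & fmul u L =1 (fun=> 0).

(* Formal series are represented by their coefficient functions int -> K. *)
Definition caratheodory u (n : int) : K :=
  if n == 0 then moment u 0 else if 0 < n then 2 * moment u (- n) else 0.

Definition series_mul (F : int -> K) L (n : int) : K :=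
  \sum_(j <- msupp L) F (n - j) * L@_j.

Definition spectral_transformation (F G : int -> K) L M C : Prop :=
  forall n, series_mul F L n = series_mul G M n + C@_n.

Definition II u v (P : laurent K * laurent K) : Prop :=
  [/\ P.1 != 0, P.2 != 0 & fmul u P.1 =1 fmul v P.2].

Definition pair_le (P Q : laurent K * laurent K) : Prop :=
  exists N, Q = (N * P.1, N * P.2).

Definition pair_equiv (P Q : laurent K * laurent K) : Prop :=
  exists2 N, laurentU N & Q = (N * P.1, N * P.2).

Definition minimal_relation u v L M : Prop :=
  II u v (L, M) /\
  forall P, II u v P -> pair_le P (L, M) -> pair_equiv P (L, M).

End Functionals.

(* Main.v *)
(** For large [n] the coefficient of [z^n] in [F L] is twice the moment of [u L] at
    [z^(-n)], and for small [n] it vanishes. Hence [u L = v M] makes [C] a Laurent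
    polynomial, and dividing the relation by [N] divides [C] by [N]. Conversely, if
    [D] divides [L], [M] and [C], then [F (L/D) = G (M/D) + C/D] shows that the
    moments at [z^(-n)] of [w = u (L/D) - v (M/D)] vanish for large [n]; since
    [w D = 0] is a linear recurrence for these moments, [w = 0]. *)
Require Import Defs.
From mathcomp Require Import all_boot all_order all_algebra.
From mathcomp Require Import finmap monalg complex reals.
From mathcomp Require Import zify.

Set Implicit Arguments.
Unset Strict Implicit.
Unset Printing Implicit Defensive.

Import Order.TTheory GRing.Theory Num.Theory.

Local Open Scope ring_scope.

(** * Laurent polynomials: extremal coefficients, absence of zero divisors, units *)

Section LaurentDomain.
Variable K : fieldType.
Implicit Types f g h : laurent K.

Lemma laurent_supp_bound f : exists b : nat, forall i, i \in msupp f -> (`|i| <= b)%N.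
Proof.
exists (\sum_(i <- msupp f) `|i|)%N => i fi.
by rewrite (big_rem i) //= leq_addr.
Qed.

(* [s = 1] selects the leading and [s = -1] the trailing coefficient. *)
Lemma laurent_extremal (s : int) f : f != 0 ->
  exists2 j, j \in msupp f & forall i, i \in msupp f -> s * i <= s * j.
Proof.
move=> f0.
have [i0 fi0] : exists i, i \in msupp f.
  apply/fset0Pn; apply: contraNneq f0 => f0.
  by apply/eqP/malgP => i; rewrite mcoeff0 mcoeff_outdom // f0.
pose j := [arg max_(i > [` fi0]%fset) (s * val i)]%O.
exists (val j); first exact: valP.
move=> i fi; rewrite /j; case: arg_maxP => //= k _ /(_ [` fi]%fset isT).
by [].
Qed.

Lemma lcoefM_extremal (s j k : int) f g : s != 0 ->
    (forall i, i \in msupp f -> s * i <= s * j) ->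
    (forall i, i \in msupp g -> s * i <= s * k) ->
  (f * g)@_(j + k) = f@_j * g@_k.
Proof.
move=> s0 fj gk; rewrite lcoefM.
have z i : i \in msupp f -> i != j -> f@_i * g@_(j + k - i) = 0.
  move=> fi ij; rewrite (@mcoeff_outdom _ _ g) ?mulr0 //.
  apply/negP => /gk le2; have le1 := fj _ fi.
  have : s * (i - j) = 0 by lia.
  by move/eqP; rewrite mulf_eq0 (negbTE s0) subr_eq0 (negbTE ij).
have [fj'|fj'] := boolP (j \in msupp f).
  rewrite (bigD1_seq j) ?fset_uniq //= big_seq_cond big1 ?addr0 => [|i /andP[]]; last exact: z.
  by congr (_ * g@_ _); lia.
rewrite (mcoeff_outdom fj') mul0r big_seq big1 // => i fi; apply: z => //.
by apply: contraNneq fj' => <-.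
Qed.

Lemma laurent_mulf_eq0 f g : f * g = 0 -> f = 0 \/ g = 0.
Proof.
move=> fg0; have [->|f0] := eqVneq f 0; first by left.
have [->|g0] := eqVneq g 0; first by right.
have [j fj jm] := laurent_extremal 1 f0.
have [k gk km] := laurent_extremal 1 g0.
have := @lcoefM_extremal 1 j k f g isT jm km.
rewrite fg0 mcoeff0 => /esym/eqP; rewrite mulf_eq0.
by rewrite !mcoeff_eq0 fj gk.
Qed.

Lemma laurent_mulIf h f g : h != 0 -> f * h = g * h -> f = g.
Proof.
move=> h0 /eqP; rewrite -subr_eq0 -mulrBl => /eqP/laurent_mulf_eq0 [/subr0_eq //|].
by move/eqP; rewrite (negbTE h0).
Qed.

(** If [h * f = 1], the top degrees of [f] and [h] add up to 0, and so do the bottom degrees. Hence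
    [f] has a single exponent. *)
Lemma laurentU_dvd1 f : laurentU f <-> ldvd f 1.
Proof.
split=> [[a [k [a0 ->]]]|[h hf1]].
  exists (a^-1 *: zpow K (- k)).
  by rewrite -scalerAl -scalerAr scalerA mulVf // scale1r lmonM mulr1 addNr.
have f0 : f != 0 by apply: contra_eq_neq hf1 => ->; rewrite mulr0 oner_neq0.
have h0 : h != 0 by apply: contra_eq_neq hf1 => ->; rewrite mul0r oner_neq0.
have top (s : int) : s != 0 -> exists j k, [/\ j \in msupp f, k \in msupp h,
    forall i, i \in msupp f -> s * i <= s * j,
    forall i, i \in msupp h -> s * i <= s * k & k + j = 0].
  move=> s0; have [j fj jm] := laurent_extremal s f0.
  have [k hk km] := laurent_extremal s h0.
  exists j, k; split => //; have := lcoefM_extremal s0 km jm.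
  rewrite -hf1 mcoeffU; case: eqVneq => // _ /esym/eqP.
  by rewrite mulf_eq0 !mcoeff_eq0 fj hk.
have [a [c [fa hc am cm ca]]] := top 1 isT.
have [b [d [fb hd bm dm db]]] := top (-1) isT.
(* Here [c = - a] and [d = - b] are the top and bottom degrees of [h], so [d <= c] gives [a <= b],
   while [b <= i <= a]. *)
have supp i : i \in msupp f -> i = a.
  move=> fi; have := am _ fi; have := bm _ fi; have := cm _ hd.
  have := dm _ hc; lia.
exists f@_a, a; split; first by rewrite mcoeff_neq0.
apply/malgP => n; rewrite mcoeffZ mcoeffU.
have [<-|an] := eqVneq a n; first by rewrite mulr1.
by rewrite mulr0 mcoeff_outdom //; apply: contra_neqN an => /supp.
Qed.

Lemma laurent_of_finsupp (X : int -> K) (b : nat) :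
  (forall n, (b < `|n|)%N -> X n = 0) -> exists f, forall n, f@_n = X n.
Proof.
(* The shift by [b] lets the ordinals below [2b + 1] enumerate the exponents from [-b] to [b]. *)
move=> X0; exists (\sum_(i < b.*2.+1) X (i%:Z - b%:Z) *: zpow K (i%:Z - b%:Z)) => n.
rewrite raddf_sum /=.
have cE (i : 'I_b.*2.+1) : (X (i%:Z - b%:Z) *: zpow K (i%:Z - b%:Z))@_n
    = if i%:Z - b%:Z == n then X n else 0.
  by rewrite mcoeffZ mcoeffU; case: eqVneq => [->|]; rewrite ?mulr1 ?mulr0.
rewrite (eq_bigr _ (fun i _ => cE i)) -big_mkcond /=.
have [nb|nb] := leqP `|n|%N b; last first.
  by rewrite big1 ?X0 // => i /eqP <-.
have nlt : (absz (n + b%:Z)%R < b.*2.+1)%N by lia.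
rewrite (big_pred1 (Ordinal nlt)) // => i.
by apply/eqP/eqP => [e|->]; [apply: val_inj => /=|move=> /=]; lia.
Qed.

End LaurentDomain.

(** * Products of two-sided formal series with Laurent polynomials *)

Section FormalSeries.
Variable K : numClosedFieldType.
Implicit Types (X Y : int -> K) (L M N C D : laurent K).
Implicit Types u v : {scalar laurent K}.

Lemma series_mulE_sub X L (d : {fset int}) n : (msupp L `<=` d)%fset ->
  series_mul X L n = \sum_(j <- d) X (n - j) * L@_j.
Proof.
by move=> Ld; apply: big_fset_incl Ld _ => i _ /mcoeff_outdom ->; rewrite mulr0.
Qed.

Lemma series_mul0 X n : series_mul X 0 n = 0.
Proof. by rewrite /series_mul msupp0 big_seq_fset0. Qed.

Lemma series_mulD X L M n :
  series_mul X (L + M) n = series_mul X L n + series_mul X M n.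
Proof.
pose d := (msupp L `|` msupp M `|` msupp (L + M))%fset.
rewrite !(series_mulE_sub _ _ (d := d)); last 3 first.
- exact: fsubset_trans (fsubsetUr _ _) (fsubsetUl _ _).
- exact: fsubset_trans (fsubsetUl _ _) (fsubsetUl _ _).
- exact: fsubsetUr.
by rewrite -big_split; apply: eq_bigr => i _; rewrite mcoeffD mulrDr.
Qed.

Lemma series_mulU X a i n : series_mul X << a *g i >> n = X (n - i) * a.
Proof.
by rewrite (series_mulE_sub _ _ (msuppU_le (k := i))) big_seq_fset1 mcoeffUU.
Qed.

Lemma series_mulA X L M n : series_mul X (L * M) n = series_mul (series_mul X L) M n.
Proof.
elim/laurent_ind: M n => [|M1 M2 e1 e2|b j] n; first by rewrite mulr0 !series_mul0.
  by rewrite mulrDr !series_mulD e1 e2.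
rewrite series_mulU; elim/laurent_ind: L => [|L1 L2 e1 e2|a i].
- by rewrite mul0r !series_mul0 mul0r.
- by rewrite mulrDl !series_mulD e1 e2 mulrDl.
by rewrite lmonM !series_mulU mulrA; congr (X _ * _ * _); lia.
Qed.

Lemma series_mul_coef C L n : series_mul (fun k => C@_k) L n = (C * L)@_n.
Proof. by rewrite mulrC lcoefM; apply: eq_bigr => i _; rewrite mulrC. Qed.

Lemma eq_series_mul X Y L n : X =1 Y -> series_mul X L n = series_mul Y L n.
Proof. by move=> XY; apply: eq_bigr => i _; rewrite XY. Qed.

Lemma series_mulDl X Y L n :
  series_mul (fun k => X k + Y k) L n = series_mul X L n + series_mul Y L n.
Proof. by rewrite -big_split; apply: eq_bigr => i _; rewrite mulrDl. Qed.

Lemma series_mulBl X Y L n :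
  series_mul (fun k => X k - Y k) L n = series_mul X L n - series_mul Y L n.
Proof. by rewrite -sumrB; apply: eq_bigr => i _; rewrite mulrBl. Qed.

(* [D] acts as a linear recurrence with invertible extremal coefficients. *)
Lemma series_mul_eq0 (s b : int) X D : s != 0 -> D != 0 ->
    (forall n, b < s * n -> X n = 0) -> series_mul X D =1 (fun=> 0) ->
  X =1 (fun=> 0).
Proof.
move=> s0 D0 Xb XD; have [j Dj jm] := laurent_extremal s D0.
(* The range where [X] is known to vanish grows by one at each step, downwards for [s = 1] and
   upwards for [s = -1]. *)
have step (k : nat) : forall n, b - k%:Z < s * n -> X n = 0.
  elim: k => [|k IHk] n; first by rewrite subr0 => /Xb.
  (* In the coefficient at [n + j] the extremal term is [X n * D@_j]; every other term has a factor
     [X (n + j - i)] with [s * (j - i) > 0], which vanishes by induction. *)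
  move=> bn; have := XD (n + j).
  rewrite /series_mul (bigD1_seq j) ?fset_uniq //= big_seq_cond big1 ?addr0 => [|i /andP[Di ij]].
    by rewrite addrK => /eqP; rewrite mulf_eq0 mcoeff_eq0 Dj orbF => /eqP.
  rewrite IHk ?mul0r //.
  have : s * (j - i) != 0 by rewrite mulf_neq0 // subr_eq0 eq_sym.
  by have := jm _ Di; lia.
by move=> n; apply: (step (absz (b - s * n + 1))); lia.
Qed.

(** * Moments of functionals and coefficients of Carathéodory series *)

Lemma eq_functional u v : (forall n, moment u n = moment v n) -> u =1 v.
Proof.
move=> uv f; rewrite (laurentE f) !linear_sum; apply: eq_bigr => i _ /=.
have -> : << f@_i *g i >> = f@_i *: zpow K i.
  by apply/malgP => n; rewrite mcoeffZ !mcoeffU mulrnAr mulr1.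
by rewrite !linearZ /= -/(moment u i) uv.
Qed.

(** With the moment at [z^(-n)] as the coefficient of [z^n], multiplying a functional by [L] becomes
    multiplying a series by [L], so recurrence arguments apply to functionals. *)
Lemma series_mul_moment u L n :
  series_mul (fun k => moment u (- k)) L n = moment (fmul u L) (- n).
Proof.
rewrite /moment /= /fmul {2}(laurentE L) mulr_suml linear_sum.
apply: eq_bigr => i _ /=.
have -> : (<< L@_i *g i >> : laurent K) * zpow K (- n) = L@_i *: zpow K (- (n - i)).
  apply/malgP => m; rewrite lmonM mcoeffZ !mcoeffU mulrnAr !mulr1.
  by rewrite opprB.
by rewrite linearZ mulrC.
Qed.

Lemma caratheodory_mul_small u L (b : nat) :
    (forall i, i \in msupp L -> (`|i| <= b)%N) ->
  forall n, n < - b%:Z -> series_mul (caratheodory u) L n = 0.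
Proof.
move=> Lb n nb; rewrite /series_mul big_seq big1 // => i /Lb ib.
by rewrite /caratheodory !ifF ?mul0r //; lia.
Qed.

(** All indices [n - i] with [i] in the support are positive, so the exceptional constant term and
    the cut-off at negative indices are never met. *)
Lemma caratheodory_mul_large u L (b : nat) :
    (forall i, i \in msupp L -> (`|i| <= b)%N) ->
  forall n, b%:Z < n -> series_mul (caratheodory u) L n = 2 * moment (fmul u L) (- n).
Proof.
move=> Lb n nb; rewrite -series_mul_moment mulr_sumr.
rewrite /series_mul !big_seq; apply: eq_bigr => i /Lb ib.
rewrite /caratheodory ifF; last lia.
by rewrite ifT ?mulrA //; lia.
Qed.

(** * Spectral transformations: existence, multiplication, uniqueness and cancellation *)

Lemma spectral_transformation_exists u v L M : fmul u L =1 fmul v M ->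
  exists C, spectral_transformation (caratheodory u) (caratheodory v) L M C.
Proof.
move=> uLvM; have [a La] := laurent_supp_bound L.
have [b Mb] := laurent_supp_bound M.
have Lab i : i \in msupp L -> (`|i| <= a + b)%N by move/La; lia.
have Mab i : i \in msupp M -> (`|i| <= a + b)%N by move/Mb; lia.
(* Outside [[-(a + b), a + b]] the difference vanishes: below, both products are 0; above, they are
   twice equal moments. *)
have [|C CE] := @laurent_of_finsupp K (fun n => series_mul (caratheodory u) L n -
    series_mul (caratheodory v) M n) (a + b).
  move=> n abn; have [n0|n0] := leP 0 n; last first.
    by rewrite !(@caratheodory_mul_small _ _ (a + b)) ?subrr //; lia.
  rewrite !(@caratheodory_mul_large _ _ (a + b)) //; try lia.
  by apply/eqP; rewrite subr_eq0; apply/eqP; congr (2 * _); apply: uLvM.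
by exists C => n; rewrite CE addrC subrK.
Qed.

Lemma spectral_transformationM u v L M C N :
    spectral_transformation (caratheodory u) (caratheodory v) L M C ->
  spectral_transformation (caratheodory u) (caratheodory v) (L * N) (M * N) (C * N).
Proof.
move=> h n; rewrite !series_mulA -series_mul_coef -series_mulDl.
exact: eq_series_mul.
Qed.

Lemma spectral_transformation_unique u v L M C C' :
    spectral_transformation (caratheodory u) (caratheodory v) L M C ->
    spectral_transformation (caratheodory u) (caratheodory v) L M C' -> C = C'.
Proof.
by move=> h h'; apply/malgP => n; have := h n; rewrite h' => /addrI.
Qed.

Lemma spectral_transformation_cancel u v L M C D : D != 0 ->
    spectral_transformation (caratheodory u) (caratheodory v) (L * D) (M * D) (C * D) ->
  spectral_transformation (caratheodory u) (caratheodory v) L M C.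
Proof.
move=> D0 h; have [a La] := laurent_supp_bound L.
have [b Mb] := laurent_supp_bound M; have [c Cc] := laurent_supp_bound C.
suff X0 : (fun n => series_mul (caratheodory u) L n -
    (series_mul (caratheodory v) M n + C@_n)) =1 (fun=> 0).
  by move=> n; apply/subr0_eq/X0.
(* The defect series has only finitely many negative powers, so the recurrence runs upwards, solved
   for by the trailing coefficient of [D]. *)
apply: (@series_mul_eq0 (-1) (a + b + c)%N _ D) => // n.
  move=> nb; rewrite (caratheodory_mul_small _ La); last lia.
  rewrite (caratheodory_mul_small _ Mb); last lia.
  rewrite mcoeff_outdom ?addr0 ?subr0 //.
  by apply/negP => /Cc; lia.
rewrite series_mulBl series_mulDl -!series_mulA series_mul_coef.
by rewrite h subrr.
Qed.

Lemma fmul_cancel u v L M C D : D != 0 ->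
    spectral_transformation (caratheodory u) (caratheodory v) L M C ->
    fmul u (L * D) =1 fmul v (M * D) ->
  fmul u L =1 fmul v M.
Proof.
move=> D0 h uv; have [a La] := laurent_supp_bound L.
have [b Mb] := laurent_supp_bound M; have [c Cc] := laurent_supp_bound C.
pose w n := moment (fmul u L) (- n) - moment (fmul v M) (- n).
have w0 : w =1 (fun=> 0).
  (* The moment sequence is two-sided; it is the relation with [C] that makes it vanish for large
     [n], so the recurrence runs downwards from there. *)
  apply: (@series_mul_eq0 1 (a + b + c)%N _ D) => // n.
    rewrite mul1r => nb; have := h n.
    rewrite (caratheodory_mul_large _ La); last lia.
    rewrite (caratheodory_mul_large _ Mb); last lia.
    rewrite mcoeff_outdom ?addr0; last by apply/negP => /Cc; lia.
    by move/(mulfI (_ : 2 != 0 :> K)) => e; rewrite /w e ?subrr ?pnatr_eq0.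
  rewrite series_mulBl !series_mul_moment /moment /= /fmul !mulrA.
  by have := uv (zpow K (- n)); rewrite /fmul => ->; rewrite subrr.
by apply: eq_functional => n; apply/subr0_eq; have := w0 (- n); rewrite /w opprK.
Qed.

(** * Minimality and coprimality *)

Lemma not_Delta_neq0 u v L M : hermitian_functional v -> ~ Delta v ->
  fmul u L =1 fmul v M -> M != 0 -> L != 0.
Proof.
(* If [L = 0], then [vM = 0] with [M] nonzero, which puts [v] in [Delta]. *)
move=> hv nDv uv M0; apply/eqP => L0; apply: nDv; split => //.
by exists M => // f; rewrite -uv /fmul L0 mul0r linear0.
Qed.

Lemma minimal_relation_coprime u v L M C :
    hermitian_functional u /\ ~ Delta u -> hermitian_functional v /\ ~ Delta v ->
    fmul u L =1 fmul v M ->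
    spectral_transformation (caratheodory u) (caratheodory v) L M C ->
  minimal_relation u v L M <-> is_gcd [:: L; M; C] 1.
Proof.
move=> [hu nDu] [hv nDv] uv FG; split.
  move=> [[/= L0 M0 _] minLM]; split; first by move=> f _; exists f; rewrite mulr1.
  move=> D Ddvd.
  have [L1 LE] := Ddvd L (mem_head _ _).
  have [M1 ME] := Ddvd M ltac:(by rewrite !inE eqxx orbT).
  have [C1 CE] := Ddvd C ltac:(by rewrite !inE eqxx !orbT).
  have D0 : D != 0 by apply: contraNneq L0 => D0; rewrite LE D0 mulr0.
  have L10 : L1 != 0 by apply: contraNneq L0 => L10; rewrite LE L10 mul0r.
  have M10 : M1 != 0 by apply: contraNneq M0 => M10; rewrite ME M10 mul0r.
  (* The cofactors of a common divisor [D] form a smaller relation; minimality then makes its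
     multiplier, which equals [D] by cancellation, a unit. *)
  have uv1 : fmul u L1 =1 fmul v M1.
    apply: (@fmul_cancel _ _ _ _ C1 D D0); last by rewrite -LE -ME.
    by apply: spectral_transformation_cancel D0 _; rewrite -LE -ME -CE.
  have [||N Nu [LN _]] := minLM (L1, M1) => //.
    by exists D; rewrite LE ME ![D * _]mulrC.
  apply/laurentU_dvd1; suff -> : D = N by [].
  by apply: (laurent_mulIf L10); rewrite -LN LE mulrC.
move=> [_ gcd1].
have LM0 : (L == 0) = (M == 0).
  apply/idP/idP; apply: contraTT => ?; last exact: not_Delta_neq0 hu nDu (fsym uv) _.
  exact: not_Delta_neq0 hv nDv uv _.
(* If [L = M = 0], then [C = 0] too, and 0 would be a common divisor dividing 1. *)
have M0 : M != 0.
  apply/eqP => M0; have L0 : L = 0 by apply/eqP; rewrite LM0 M0.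
  have C0 : C = 0.
    by apply/malgP => n; have := FG n; rewrite L0 M0 !series_mul0 add0r mcoeff0.
  have [|h /eqP] := gcd1 0.
    by move=> f; rewrite !inE L0 M0 C0 !orbb => /eqP ->; exists 0; rewrite mulr0.
  by rewrite mulr0 oner_eq0.
split; first by split; rewrite ?LM0.
move=> [L1 M1] [/= L10 M10 uv1] [N [/= LE ME]]; exists N; last by rewrite LE ME.
(* The smaller relation has its own polynomial [C1]; multiplying by [N] and using uniqueness gives
   [C = C1 * N], so [N] divides all three. *)
have [C1 FG1] := spectral_transformation_exists uv1.
have CE : C = C1 * N.
  apply: spectral_transformation_unique FG _.
  by rewrite LE ME ![N * _]mulrC; apply: spectral_transformationM.
apply/laurentU_dvd1/gcd1 => f; rewrite !inE => /or3P[] /eqP ->.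
- by exists L1; rewrite LE mulrC.
- by exists M1; rewrite ME mulrC.
by exists C1.
Qed.

End FormalSeries.

Theorem theorem3p6 (R : realType) (u v : {scalar laurent R[i]})
    (hu : hermitian_functional u /\ ~ Delta u) (hv : hermitian_functional v /\ ~ Delta v)
    (p : int) (L M : laurent R[i])
    (hLM : (lstarp p L, lstarp p M) = (L, M))
    (huv : fmul u L =1 fmul v M) :
  (exists C : laurent R[i],
     spectral_transformation (caratheodory u) (caratheodory v) L M C) /\
  (forall C : laurent R[i],
     spectral_transformation (caratheodory u) (caratheodory v) L M C ->
     (minimal_relation u v L M <-> is_gcd [:: L; M; C] 1)).
Proof.
split; first exact: spectral_transformation_exists.
by move=> C; apply: minimal_relation_coprime.
Qed.
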